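(* Let $F$ be a field with $\operatorname{char}(F)\neq2$ and let $P$ be a Poisson algebra over $F$. Define on $P$ the bilinear product $$x*y=xy+[x,y].$$ Then $(P,* )$ is power-associative. A vector subspace of $P$ is a $*$-subalgebra if and only if it is a Poisson subalgebra, and it is a two-sided $*$-ideal if and only if it is a Poisson ideal. Consequently, $P$ is a Dedekind Poisson algebra if and only if $(P,* )$ is an $H$-algebra.
   Context: A Poisson algebra over a field $F$ is an $F$-vector space $P$ with a bilinear commutative associative multiplication $xy$ (no identity element is assumed) and an alternating Lie bracket $[\,,\,]$ ($[x,x]=0$ for all $x$) satisfying $[xy,z]=x[y,z]+y[x,z]$. A Poisson subalgebra is a subspace closed under both operations; a Poisson ideal is a subspace $I$ with $PI\subseteq I$ and $[P,I]\subseteq I$. A Poisson algebra is Dedekind if every Poisson subalgebra is a Poisson ideal. No finite-dimensionality is assumed. A (not necessarily associative) algebra is power-associative if every subalgebra generated by one element is associative. An $H$-algebra is a (not necessarily associative) algebra in which every subalgebra is a two-sided ideal. A $*$-subalgebra is a subspace closed under $*$; a two-sided $*$-ideal is a subspace $I$ with $P*I\subseteq I$ and $I*P\subseteq I$. *)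

(* Defs.v *)
From HB Require Import structures.
From mathcomp Require Import all_boot all_order all_algebra.

Set Implicit Arguments.
Unset Strict Implicit.
Unset Printing Implicit Defensive.

Import GRing.Theory.
Local Open Scope ring_scope.

(* Subspaces are Prop-valued predicates, so that arbitrary (not necessarily   *)
(* decidable) subspaces of a possibly infinite-dimensional space are covered. *)
Definition is_subspace (F : fieldType) (V : lmodType F) (S : V -> Prop) : Prop :=
  S 0 /\ forall (a : F) (u v : V), S u -> S v -> S (a *: u + v).

(* A not necessarily associative, not necessarily unital algebra is a vector  *)
(* space A together with a bilinear m : {bilinear A -> A -> A}.               *)
Definition is_subalgebra (F : fieldType) (A : lmodType F)
    (m : {bilinear A -> A -> A}) (S : A -> Prop) : Prop :=
  is_subspace S /\ forall x y : A, S x -> S y -> S (m x y).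

Definition is_ideal (F : fieldType) (A : lmodType F)
    (m : {bilinear A -> A -> A}) (I : A -> Prop) : Prop :=
  [/\ is_subspace I,
      forall x y : A, I y -> I (m x y)
    & forall x y : A, I x -> I (m x y)].

Definition generated_subalgebra (F : fieldType) (A : lmodType F)
    (m : {bilinear A -> A -> A}) (x : A) : A -> Prop :=
  fun y => forall S : A -> Prop, is_subalgebra m S -> S x -> S y.

Definition power_associative (F : fieldType) (A : lmodType F)
    (m : {bilinear A -> A -> A}) : Prop :=
  forall x a b c : A,
    generated_subalgebra m x a -> generated_subalgebra m x b ->
    generated_subalgebra m x c -> m (m a b) c = m a (m b c).

Definition is_Halgebra (F : fieldType) (A : lmodType F)
    (m : {bilinear A -> A -> A}) : Prop :=
  forall S : A -> Prop, is_subalgebra m S -> is_ideal m S.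

Record is_poisson (F : fieldType) (P : lmodType F)
    (mul brk : {bilinear P -> P -> P}) : Prop := IsPoisson {
  poisson_mulC : forall x y : P, mul x y = mul y x;
  poisson_mulA : forall x y z : P, mul x (mul y z) = mul (mul x y) z;
  poisson_brkxx : forall x : P, brk x x = 0;
  poisson_jacobi : forall x y z : P,
    brk x (brk y z) + brk y (brk z x) + brk z (brk x y) = 0;
  poisson_leibniz : forall x y z : P,
    brk (mul x y) z = mul x (brk y z) + mul y (brk x z)
}.

Definition is_poisson_subalgebra (F : fieldType) (P : lmodType F)
    (mul brk : {bilinear P -> P -> P}) (S : P -> Prop) : Prop :=
  [/\ is_subspace S,
      forall x y : P, S x -> S y -> S (mul x y)
    & forall x y : P, S x -> S y -> S (brk x y)].

Definition is_poisson_ideal (F : fieldType) (P : lmodType F)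
    (mul brk : {bilinear P -> P -> P}) (I : P -> Prop) : Prop :=
  [/\ is_subspace I,
      forall x y : P, I y -> I (mul x y)
    & forall x y : P, I y -> I (brk x y)].

Definition is_dedekind (F : fieldType) (P : lmodType F)
    (mul brk : {bilinear P -> P -> P}) : Prop :=
  forall S : P -> Prop,
    is_poisson_subalgebra mul brk S -> is_poisson_ideal mul brk S.

Definition star (F : fieldType) (P : lmodType F)
    (mul brk : {bilinear P -> P -> P}) (x y : P) : P :=
  mul x y + brk x y.

Lemma star_is_bilinear (F : fieldType) (P : lmodType F)
    (mul brk : {bilinear P -> P -> P}) :
  bilinear_for *:%R *:%R (star mul brk).
Proof.
split=> [z a x y | z a x y] /=; rewrite /star.
  by rewrite !linearPl /= scalerDr addrACA.
by rewrite !linearPr /= scalerDr addrACA.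
Qed.

HB.instance Definition _ (F : fieldType) (P : lmodType F)
    (mul brk : {bilinear P -> P -> P}) :=
  bilinear_isBilinear.Build F P P P *:%R *:%R (star mul brk)
    (star_is_bilinear mul brk).

(* Main.v *)
Require Import Defs.
From mathcomp Require Import all_boot all_order all_algebra.

Set Implicit Arguments.
Unset Strict Implicit.
Unset Printing Implicit Defensive.

Import GRing.Theory.
Local Open Scope ring_scope.

(** The product [xy] is the symmetric part of [x * y] and the bracket its
    antisymmetric part: [x * y + y * x = 2xy] and [x * y - y * x = 2[x,y]].
    Since 2 is invertible, a subspace containing both [x * y] and [y * x] is the
    same thing as one containing both [xy] and [[x,y]]; this pointwise fact
    ([star_comm_mem]) translates subalgebras into subalgebras, ideals into
    ideals, and hence the Dedekind property into the [H]-property.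

    For power-associativity, it is enough that the bracket vanishes on the
    [*]-subalgebra generated by [x], because there [*] is then the associative
    product of [P].  The centralizer of any element is a [*]-subalgebra, by the
    Leibniz and Jacobi identities.  The centralizer of [x] contains [x], hence
    every [b] generated by [x]; so the centralizer of such a [b] contains [x],
    hence every [a] generated by [x], that is [[a,b] = 0]. *)

Section Subspace.
Variables (F : fieldType) (V : lmodType F) (S : V -> Prop).
Hypothesis subS : is_subspace S.

Lemma subspaceZ (a : F) (u : V) : S u -> S (a *: u).
Proof. by case: subS => S0 SZD Su; rewrite -[_ *: _]addr0; apply: SZD. Qed.

Lemma subspaceD (u v : V) : S u -> S v -> S (u + v).
Proof. by case: subS => _ SZD Su Sv; rewrite -[u]scale1r; apply: SZD. Qed.

Lemma subspaceN (u : V) : S u -> S (- u).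
Proof. by rewrite -scaleN1r; apply: subspaceZ. Qed.

Lemma subspace_half (u : V) : 2%N \notin [pchar F] -> S (u *+ 2) -> S u.
Proof.
move=> charF Su2; have two_neq0 : 2%:R != 0 :> F by rewrite inE in charF.
by rewrite -[u]scale1r -(mulVf two_neq0) -scalerA scaler_nat; apply: subspaceZ.
Qed.

End Subspace.

Section Star.
Variables (F : fieldType) (P : lmodType F) (mul brk : {bilinear P -> P -> P}).
Hypothesis poissonP : is_poisson mul brk.

Let mulC := poisson_mulC poissonP.

Lemma brk_antisym (x y : P) : brk y x = - brk x y.
Proof.
have brkxx := poisson_brkxx poissonP; apply/eqP; rewrite -addr_eq0 addrC.
have := brkxx (x + y); rewrite linearDl /= !linearDr /= !brkxx add0r addr0.
by move=> ->.
Qed.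

Lemma star_sym (x y : P) : star mul brk y x = mul x y - brk x y.
Proof. by rewrite /star mulC brk_antisym. Qed.

Lemma star_comm_mem (S : P -> Prop) (x y : P) :
    2%N \notin [pchar F] -> is_subspace S ->
  S (star mul brk x y) /\ S (star mul brk y x) <-> S (mul x y) /\ S (brk x y).
Proof.
move=> charF subS; rewrite (star_sym x y) /star; split=> -[S1 S2]; last first.
  by split; apply: (subspaceD subS) => //; apply: (subspaceN subS).
split; apply: (subspace_half subS charF); rewrite mulr2n.
  by have := subspaceD subS S1 S2; rewrite addrACA subrr addr0.
have := subspaceD subS S1 (subspaceN subS S2).
by rewrite opprB [mul x y + _]addrC addrACA subrr addr0.
Qed.

Lemma star_subalgebraP (S : P -> Prop) : 2%N \notin [pchar F] ->
  is_subalgebra (star mul brk) S <-> is_poisson_subalgebra mul brk S.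
Proof.
move=> charF; split=> [[subS Sstar] | [subS Smul Sbrk]].
  have Sxy x y : S x -> S y -> S (mul x y) /\ S (brk x y).
    by move=> Sx Sy; apply/(star_comm_mem x y charF subS); split; apply: Sstar.
  by split=> // x y Sx Sy; case: (Sxy x y Sx Sy).
split=> // x y Sx Sy.
by apply: (subspaceD subS); [apply: Smul | apply: Sbrk].
Qed.

(** A Poisson ideal is only required to absorb on the left, so its two-sided
    absorption for [*] rests on the symmetry of the product and the antisymmetry
    of the bracket. *)
Lemma star_idealP (I : P -> Prop) : 2%N \notin [pchar F] ->
  is_ideal (star mul brk) I <-> is_poisson_ideal mul brk I.
Proof.
move=> charF; split=> [[subI Il Ir] | [subI Imul Ibrk]].
  have Ixy x y : I y -> I (mul x y) /\ I (brk x y).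
    by move=> Iy; apply/(star_comm_mem x y charF subI); split;
      [apply: Il | apply: Ir].
  by split=> // x y /(Ixy x)[].
have Ixy x y : I y -> I (star mul brk x y) /\ I (star mul brk y x).
  by move=> Iy; apply/(star_comm_mem x y charF subI); split;
    [apply: Imul | apply: Ibrk].
by split=> // x y; [case/(Ixy x) | case/(Ixy y)].
Qed.

(** Leibniz makes the centralizer closed under the product, Jacobi under the
    bracket. *)
Lemma centralizer_subalgebra (y : P) :
  is_subalgebra (star mul brk) (fun a => brk a y = 0).
Proof.
split=> [|a b ay0 by0].
  split=> [|a u v uy0 vy0]; first by rewrite linear0l.
  by rewrite linearPl /= uy0 vy0 scaler0 addr0.
rewrite /star linearDl /= (poisson_leibniz poissonP) ay0 by0 !linear0r !add0r.
have := poisson_jacobi poissonP a b y.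
rewrite by0 (brk_antisym a y) ay0 oppr0 !linear0r !add0r => yab0.
by rewrite brk_antisym yab0 oppr0.
Qed.

(** A double centralizer argument: membership in the generated subalgebra is
    used first for [b] against the centralizer of [x], then for [a] against the
    centralizer of [b]. *)
Lemma generated_brk0 (x a b : P) :
    generated_subalgebra (star mul brk) x a ->
    generated_subalgebra (star mul brk) x b ->
  brk a b = 0.
Proof.
move=> xa xb; apply: (xa _ (centralizer_subalgebra b)).
rewrite brk_antisym (xb _ (centralizer_subalgebra x)) ?oppr0 //.
exact: poisson_brkxx poissonP x.
Qed.

Lemma star_power_associative : power_associative (star mul brk).
Proof.
move=> x a b c xa xb xc.
have xstar u v : generated_subalgebra (star mul brk) x u ->
    generated_subalgebra (star mul brk) x v ->
    generated_subalgebra (star mul brk) x (star mul brk u v).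
  move=> xu xv S algS Sx; case: (algS) => _ Sstar.
  by apply: Sstar; [apply: xu | apply: xv].
have starE u v : generated_subalgebra (star mul brk) x u ->
    generated_subalgebra (star mul brk) x v -> star mul brk u v = mul u v.
  by move=> xu xv; rewrite /star (generated_brk0 xu xv) ?addr0.
rewrite /= (starE _ c _ xc) ?(starE a (star _ _ _ _) xa); try exact: xstar.
by rewrite (starE a b) // (starE b c) // (poisson_mulA poissonP).
Qed.

End Star.

Theorem proposition3p2 (F : fieldType) (charF : 2%N \notin [pchar F])
    (P : lmodType F) (mul brk : {bilinear P -> P -> P})
    (poissonP : is_poisson mul brk) :
  [/\ power_associative (star mul brk),
      forall S : P -> Prop, is_subspace S ->
        (is_subalgebra (star mul brk) S <-> is_poisson_subalgebra mul brk S),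
      forall I : P -> Prop, is_subspace I ->
        (is_ideal (star mul brk) I <-> is_poisson_ideal mul brk I)
    & is_dedekind mul brk <-> is_Halgebra (star mul brk)].
Proof.
have subalgP S := star_subalgebraP poissonP S charF.
have idealP I := star_idealP poissonP I charF.
split=> //; first exact: star_power_associative.
by split=> hyp S /subalgP/hyp/idealP.
Qed.
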